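(* Let $P$ be a poset. The inclusion map $\sigma\colon P\hookrightarrow S(P)$, $x\mapsto x$, is a sum-completion of $P$.
   Context: In a poset $P$, $x\circ y$ (overlap) means that there is $z\in P$ with $z\le x$ and $z\le y$. For $A\subseteq P$ and $x\in P$, $A\le x$ means $a\le x$ for all $a\in A$; and $x\prec A$ means that for every $y\le x$ there is $z\in A$ with $y\circ z$. Put $\overline{A}=\{x\in P\mid x\prec A\}$. For $A\neq\varnothing$, $x$ is a sum of $A$ if $A\le x$ and $x\prec A$. A poset is sum-complete if every nonempty subset has a sum. An order-embedding is a map $f$ with $x\le y\iff f(x)\le f(y)$. A map $f\colon P\to M$ is sum-dense if for every $m\in M$ there is $A\subseteq P$ such that $m$ is a sum of $f(A)$ in $M$. A sum-completion of $P$ is a sum-complete poset $M$ together with a sum-dense order-embedding $e\colon P\to M$. $S(P)$ is the set $P\cup\{s_{\overline{A}}\mid \varnothing\neq A\subseteq P \text{ has no sum in }P\}$, where the $s_{\overline{A}}$ are new formal elements not in $P$, indexed by the sets $\overline{A}$ (so $s_{\overline{A}}=s_{\overline{B}}$ iff $\overline{A}=\overline{B}$). It is partially ordered by $\sqsubseteq$, defined for $x,y\in P$ and nonempty $A,B\subseteq P$ without a sum in $P$ by: $x\sqsubseteq y$ iff $x\le y$; $x\sqsubseteq s_{\overline{A}}$ iff $x\in\overline{A}$; $s_{\overline{A}}\sqsubseteq s_{\overline{B}}$ iff $\overline{A}\subseteq\overline{B}$; $s_{\overline{A}}\sqsubseteq x$ iff $\overline{A}\le x$. *)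

(* Defs.v *)
From HB Require Import structures.
From mathcomp Require Import all_boot all_order.
From mathcomp Require Import boolp classical_sets.
Set Implicit Arguments.
Unset Strict Implicit.
Unset Printing Implicit Defensive.
Import Order.TTheory.
Local Open Scope classical_set_scope.
Local Open Scope order_scope.

(* Throughout, [A <= x] (every element of A is below x) is [ubound A x]. *)

Section Sums.
Context {d : Order.disp_t} {P : porderType d}.
Implicit Types (A : set P) (x y z : P).

Definition overlap x y : Prop := exists z, z <= x /\ z <= y.

(* [prec x A] is the relation written x \prec A. *)
Definition prec x A : Prop :=
  forall y, y <= x -> exists z, A z /\ overlap y z.

(* [prec_closure A] is the set written \overline{A}. *)
Definition prec_closure A : set P := [set x | prec x A].

Definition is_sum A x : Prop := [/\ A !=set0, ubound A x & prec x A].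

Definition has_sum A : Prop := exists x, is_sum A x.

Lemma sub_prec_closure A : A `<=` prec_closure A.
Proof. by move=> x Ax y yx; exists x; split=> //; exists y. Qed.

Lemma prec_closure_down A x y : x <= y -> prec_closure A y -> prec_closure A x.
Proof. by move=> xy Ay z zx; apply: Ay; exact: le_trans zx xy. Qed.

End Sums.

Definition sum_complete {d : Order.disp_t} (P : porderType d) : Prop :=
  forall A : set P, A !=set0 -> has_sum A.

Definition sum_dense {d d' : Order.disp_t} {P : porderType d}
    {M : porderType d'} (f : P -> M) : Prop :=
  forall m : M, exists A : set P, is_sum (f @` A) m.

Definition order_embedding {d d' : Order.disp_t} {P : porderType d}
    {M : porderType d'} (f : P -> M) : Prop :=
  {mono f : x y / x <= y}.

Definition is_sum_completion {d d' : Order.disp_t} {P : porderType d}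
    {M : porderType d'} (e : P -> M) : Prop :=
  [/\ sum_complete M, sum_dense e & order_embedding e].

(* An index of a formal element s_{\overline{A}}: a set of the form \overline{A}
   for some nonempty A without a sum. The witness A is not part of the data, so
   two indices are equal as soon as their underlying sets are. *)
Record sum_index {d : Order.disp_t} (P : porderType d) := SumIndex {
  index_set :> set P;
  index_setP : exists A : set P,
    [/\ A !=set0, ~ has_sum A & index_set = prec_closure A]
}.

Inductive sum_ext {d : Order.disp_t} (P : porderType d) : Type :=
  | sum_incl of P
  | formal_sum of sum_index P.

Arguments sum_incl {d P} x.
Arguments formal_sum {d P} D.

Section SumExtOrder.
Context {d : Order.disp_t} {P : porderType d}.
Implicit Types (u v : sum_ext P) (D : sum_index P).

HB.instance Definition _ := gen_eqMixin (sum_ext P).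
HB.instance Definition _ := gen_choiceMixin (sum_ext P).

Definition sum_ext_leP u v : Prop :=
  match u, v with
  | sum_incl x, sum_incl y => x <= y
  | sum_incl x, formal_sum D => index_set D x
  | formal_sum D, formal_sum E => index_set D `<=` index_set E
  | formal_sum D, sum_incl x => ubound (index_set D) x
  end.

Definition sum_ext_le u v : bool := `[< sum_ext_leP u v >].

Lemma sum_index_inj D E : index_set D = index_set E -> D = E.
Proof.
case: D E => [D hD] [E hE] /= DE; case: _ / DE hE => hE.
by congr SumIndex; exact: Prop_irrelevance.
Qed.

Lemma sum_index_down D x y : x <= y -> index_set D y -> index_set D x.
Proof.
by have [A [_ _ ->]] := index_setP D; exact: prec_closure_down.
Qed.

Lemma sum_index_no_max D x : index_set D x -> ubound (index_set D) x -> False.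
Proof.
have [A [A0 nA ->]] := index_setP D => Ax ubx; apply: nA; exists x; split=> // a Aa.
by apply: ubx; exact: sub_prec_closure.
Qed.

Lemma sum_ext_le_refl : reflexive sum_ext_le.
Proof. by case=> [x|D]; apply/asboolP => //=. Qed.

Lemma sum_ext_le_anti : antisymmetric sum_ext_le.
Proof.
move=> [x|D] [y|E] /andP[/asboolP/= h /asboolP/= k].
- by congr sum_incl; apply/le_anti/andP.
- by case: (sum_index_no_max h k).
- by case: (sum_index_no_max k h).
- by congr formal_sum; apply: sum_index_inj; apply/seteqP.
Qed.

Lemma sum_ext_le_trans : transitive sum_ext_le.
Proof.
move=> [y|E] [x|D] [z|F] /asboolP/= h /asboolP/= k; apply/asboolP => /=.
- exact: le_trans h k.
- exact: sum_index_down h k.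
- by move=> a Da; exact: le_trans (h _ Da) k.
- by move=> a Da; exact: sum_index_down (h _ Da) k.
- exact: k.
- exact: k.
- by move=> a Da; apply: k; exact: h.
- by move=> a Da; apply: k; exact: h.
Qed.

HB.instance Definition _ := Order.Le_isPOrder.Build d (sum_ext P)
  sum_ext_le_refl sum_ext_le_anti sum_ext_le_trans.

Lemma sum_ext_leE u v : (u <= v) = `[< sum_ext_leP u v >].
Proof. by []. Qed.

End SumExtOrder.

(* Main.v *)
Require Import Defs.
From mathcomp Require Import all_boot all_order.
From mathcomp Require Import boolp classical_sets.
Set Implicit Arguments.
Unset Strict Implicit.
Unset Printing Implicit Defensive.
Import Order.TTheory.
Local Open Scope classical_set_scope.
Local Open Scope order_scope.

(** Every element of [sum_ext P] has an element of [P] below it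
([exists_sum_incl_le]), and its place in the order is determined by the
elements of [P] below it ([sum_ext_le_lowerP]).  Hence the conditions
[ubound A u] and [prec u A], for a set [A] of elements of [sum_ext P], can be
tested on elements of [P], by replacing [A] with its trace [trace A], the set
of elements of [P] lying below some member of [A]
([ubound_of_trace], [prec_of_trace]).

Sum-completeness follows: if the nonempty set [trace A] has a sum [x] in [P],
then [x] is a sum of [A]; otherwise the formal sum indexed by
[prec_closure (trace A)] exists and is a sum of [A].  For sum-density, an
element [x] of [P] is the sum of its own singleton, and a formal sum indexed
by [D] is the sum of the image of [D], whose trace contains [D]. *)

Section SumExtCompletion.
Context {d : Order.disp_t} {P : porderType d}.
Implicit Types (A : set (sum_ext P)) (u v : sum_ext P) (D : sum_index P).

Lemma sum_incl_mono : {mono (sum_incl : P -> sum_ext P) : x y / x <= y}.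
Proof. by move=> x y; rewrite sum_ext_leE /= asboolb. Qed.

Lemma sum_incl_le_formal x D : (sum_incl x <= formal_sum D) = `[< index_set D x >].
Proof. by rewrite sum_ext_leE. Qed.

Lemma sum_index_nonempty D : index_set D !=set0.
Proof.
have [B [[x Bx] _ ->]] := index_setP D.
by exists x; exact: sub_prec_closure.
Qed.

Lemma exists_sum_incl_le u : exists x : P, sum_incl x <= u.
Proof.
case: u => [x|D]; first by exists x.
have [x Dx] := sum_index_nonempty D.
by exists x; rewrite sum_incl_le_formal; apply/asboolP.
Qed.

Lemma sum_ext_le_lowerP u v :
  (forall x : P, sum_incl x <= u -> sum_incl x <= v) <-> u <= v.
Proof.
split=> [uv|uv x xu]; last exact: le_trans xu uv.
case: u uv => [x|D] uv; first exact: uv.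
have Dv x : index_set D x -> sum_incl x <= v.
  by move=> Dx; apply: uv; rewrite sum_incl_le_formal; apply/asboolP.
by case: v {uv} Dv => [y|E] Dv; rewrite sum_ext_leE; apply/asboolP => x /Dv;
  rewrite ?sum_incl_mono ?sum_incl_le_formal // => /asboolP.
Qed.

(** The elements of [P] that lie below some member of [A]. *)
Definition trace A : set P := [set x | exists2 u, A u & sum_incl x <= u].

Lemma trace_nonempty A : A !=set0 -> trace A !=set0.
Proof.
by move=> [u Au]; have [x xu] := exists_sum_incl_le u; exists x, u.
Qed.

Lemma ubound_of_trace A v :
  (forall x, trace A x -> sum_incl x <= v) -> ubound A v.
Proof. by move=> Av u Au; apply/sum_ext_le_lowerP => x xu; apply: Av; exists u. Qed.

Lemma prec_of_trace A v :
  (forall x : P, sum_incl x <= v -> prec x (trace A)) -> prec v A.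
Proof.
move=> vA w wv; have [x xw] := exists_sum_incl_le w.
have [z [[u Au zu] [y [yx yz]]]] := vA x (le_trans xw wv) x (lexx x).
exists u; split=> //; exists (sum_incl y); split.
  by apply: le_trans xw; rewrite sum_incl_mono.
by apply: le_trans zu; rewrite sum_incl_mono.
Qed.

Lemma sum_ext_complete : sum_complete (sum_ext P).
Proof.
move=> A A0; have [[x [_ Ax xA]]|nA] := pselect (has_sum (trace A)).
  exists (sum_incl x); split=> //.
    by apply: ubound_of_trace => y /Ax; rewrite sum_incl_mono.
  apply: prec_of_trace => y; rewrite sum_incl_mono => yx.
  exact: prec_closure_down yx xA.
have hD : exists B : set P,
    [/\ B !=set0, ~ has_sum B & prec_closure (trace A) = prec_closure B].
  by exists (trace A); split=> //; exact: trace_nonempty.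
exists (formal_sum (SumIndex hD)); split=> //.
  apply: ubound_of_trace => y Ay; rewrite sum_incl_le_formal.
  by apply/asboolP; exact: sub_prec_closure.
by apply: prec_of_trace => y; rewrite sum_incl_le_formal => /asboolP.
Qed.

Lemma is_sum_image_index D :
  is_sum [set sum_incl x | x in index_set D] (formal_sum D).
Proof.
split; first exact: image_nonempty (sum_index_nonempty D).
  by move=> _ [x Dx <-]; rewrite sum_incl_le_formal; apply/asboolP.
apply: prec_of_trace => x; rewrite sum_incl_le_formal => /asboolP Dx.
by apply: sub_prec_closure; exists (sum_incl x) => //; exists x.
Qed.

Lemma is_sum_set1 d' (M : porderType d') (m : M) : is_sum [set m] m.
Proof.
split; [by exists m | by move=> _ -> | exact: sub_prec_closure].
Qed.

Lemma sum_incl_dense : sum_dense (sum_incl : P -> sum_ext P).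
Proof.
case=> [x|D]; last by exists (index_set D); exact: is_sum_image_index.
by exists [set x]; rewrite image_set1; exact: is_sum_set1.
Qed.

End SumExtCompletion.

Theorem theorem5p4 (d : Order.disp_t) (P : porderType d) :
  is_sum_completion (sum_incl : P -> sum_ext P).
Proof.
split; [exact: sum_ext_complete | exact: sum_incl_dense | exact: sum_incl_mono].
Qed.
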